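(* Let $r\ge 0$ be an integer, let $\Delta\subseteq\mathbb{R}^k$ be a $k$-dimensional simplicial complex, and let $\Delta'$ be a split subdivision of $\Delta$ obtained by replacing a maximal cell $\sigma\in\Delta_k$ by a subdivision $\Delta''$ of $\sigma$. Let $v:\mathcal{R}/\mathcal{J}(\Delta)\to\mathcal{R}/\mathcal{J}(\Delta')$ be the tautological chain map, with components $v_i$. Then for $i<k$, $$\operatorname{coker}(v_i)\simeq \mathcal{R}/\mathcal{J}(\Delta'')_i,$$ and in degree $k$, $$\operatorname{coker}(v_k)\simeq\Big(\bigoplus_{\sigma'\in\Delta''_k}R\Big)\Big/R,$$ where the quotient is by the diagonal copy of $R$.
   Context: $R=\mathbb{R}[x_0,\dots,x_k]$. For a $k$-dimensional (full-dimensional) simplicial complex $\Delta\subseteq\mathbb{R}^k$, $\Delta_i$ is the set of $i$-dimensional faces and $\Delta_i^0$ the set of interior $i$-dimensional faces (those not contained in the boundary $\partial(\Delta)$); all $k$-dimensional faces are considered interior, so $\Delta_k^0=\Delta_k$. $\Delta^0$ denotes the collection of interior faces. Fix a smoothness order $r\ge 0$. For a face $\tau\in\Delta_{k-1}$ let $l_{\hat\tau}\in R$ be the homogenization (with respect to $x_0$) of a linear form $l_\tau$ whose vanishing defines the affine span of $\tau$. For $\gamma\in\Delta_i^0$ with $i<k$, put $J(\Delta)_\gamma=\langle l_{\hat\tau}^{\,r+1}\mid \gamma\subseteq\tau\in\Delta_{k-1}\rangle\subseteq R$. The complex $\mathcal{R}/\mathcal{J}(\Delta)$ of graded $R$-modules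 is $$0\to\bigoplus_{\sigma\in\Delta_k}R\xrightarrow{\partial_k}\bigoplus_{\tau\in\Delta_{k-1}^0}R/J(\Delta)_\tau\xrightarrow{\partial_{k-1}}\cdots\xrightarrow{\partial_1}\bigoplus_{w\in\Delta_0^0}R/J(\Delta)_w\to 0,$$ with $\partial_i$ induced by the usual simplicial boundary operator relative to the boundary of $\Delta$; $\mathcal{R}/\mathcal{J}(\Delta)_i$ is its term in degree $i$ (indexed by $\Delta_i^0$). The same notation is used for $\Delta'$ and $\Delta''$ (each is a simplicial complex in $\mathbb{R}^k$ with its own interior faces). Simple subdivision: let $\sigma\in\Delta_k$ and let $\Delta''$ be a subdivision of $\sigma$ into a simplicial complex such that $\partial(\sigma)=\partial(\Delta'')$ on $\Delta^0$ (i.e. faces of $\sigma$ that are interior in $\Delta$ are not subdivided; the boundary of $\sigma$ may be modified only on $\sigma\cap\partial(\Delta)$). Replacing $\sigma$ by $\Delta''$ gives a simplicial complex $\Delta'$, called a simple subdivision of $\Delta$. Split subdivision: a simple subdivision $\Delta'$ such that for every $i$ and every $i$-face $\gamma$ of $\partial(\Delta'')$ that is not in $\partial(\Delta')$, one has $J(\Delta')_\gamma=J(\Delta)_\gamma$. Tautological chain map $v$: in degree $k$, $v_k$ sends the generator $1_\gamma$ of a cell $\gamma\in\Delta_k$ to $\sum_j 1_{\gamma'_j}$, the sum over the maximal cells $\gamma'_j$ of $\Delta'$ into which $\gamma$ is subdivided; in degrees $i<k$, $v_i$ is induced, i.e. on the summand of $\gamma\in\Delta_i^0$ (which is also an interior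 face of $\Delta'$) it is the natural quotient map $R/J(\Delta)_\gamma\to R/J(\Delta')_\gamma$. *)

(* Defs.v *)
From HB Require Import structures.
From mathcomp Require Import all_boot all_order all_algebra.
From mathcomp Require Import finmap generic_quotient ring_quotient.
From mathcomp Require Import boolp classical_sets functions reals topology.
From mathcomp Require Import normedtype.
(* mpoly's notations clash with those of mathcomp-analysis, so [mpoly n R] is
   written for {mpoly R[n]}, [mpolyX R (mnm1 j)] for 'X_j and
   [ishomog1 d mdeg] for d.-homog. *)
From mathcomp Require Import -(notations) mpoly.

Set Implicit Arguments.
Unset Strict Implicit.
Unset Printing Implicit Defensive.

Import Order.TTheory GRing.Theory Num.Theory.
Import numFieldNormedType.Exports.
Local Open Scope fset_scope.
Local Open Scope ring_scope.

Section LmodQuotient.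
Variables (A : nzRingType) (V : lmodType A) (N : submodClosed V).

(* In the library [submodClosed] does not inherit from [zmodClosed], which
   [Quotient.quot] requires. *)
Definition zmod_of_submod : {pred V} := N.

HB.instance Definition _ :=
  GRing.isZmodClosed.Build V zmod_of_submod (GRing.submod_closedB (submodClosedP N)).

Definition lquot : Type := Quotient.quot zmod_of_submod.

HB.instance Definition _ := GRing.Zmodule.on lquot.

Definition lproj (x : V) : lquot := (\pi_(Quotient.quot zmod_of_submod) x)%qT.
Definition lrepr (q : lquot) : V := repr (q : Quotient.quot zmod_of_submod).

Lemma lreprK : cancel lrepr lproj.
Proof. by move=> q; rewrite /lproj /lrepr reprK. Qed.

Lemma lproj_eq x y : (lproj x == lproj y) = (x - y \in (N : {pred V})).
Proof. by rewrite /lproj -Quotient.idealrBE. Qed.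

Fact lproj_is_zmod_morphism : zmod_morphism lproj.
Proof. by move=> x y; rewrite /lproj [LHS]raddfB. Qed.

HB.instance Definition _ :=
  GRing.isZmodMorphism.Build V lquot lproj lproj_is_zmod_morphism.

Definition lquot_scale (a : A) (q : lquot) : lquot := lproj (a *: lrepr q).

Lemma lquot_scale_lproj a x : lquot_scale a (lproj x) = lproj (a *: x).
Proof.
by apply/eqP; rewrite lproj_eq -scalerBr rpredZ // -lproj_eq lreprK.
Qed.

Fact lquot_scaleA a b q :
  lquot_scale a (lquot_scale b q) = lquot_scale (a * b) q.
Proof. by rewrite -[q]lreprK !lquot_scale_lproj scalerA. Qed.

Fact lquot_scale1 : left_id 1 lquot_scale.
Proof. by move=> q; rewrite -[q]lreprK lquot_scale_lproj scale1r. Qed.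

Fact lquot_scaleDr : right_distributive lquot_scale +%R.
Proof.
move=> a p q; rewrite -[p]lreprK -[q]lreprK.
by rewrite -raddfD !lquot_scale_lproj scalerDr raddfD.
Qed.

Fact lquot_scaleDl q : {morph lquot_scale^~ q : a b / a + b}.
Proof.
by move=> a b; rewrite -[q]lreprK !lquot_scale_lproj scalerDl raddfD.
Qed.

HB.instance Definition _ := GRing.Zmodule_isLmodule.Build A lquot
  lquot_scaleA lquot_scale1 lquot_scaleDr lquot_scaleDl.

Fact lproj_is_scalable : scalable lproj.
Proof. by move=> a x; rewrite -lquot_scale_lproj. Qed.

HB.instance Definition _ :=
  GRing.isScalable.Build A V lquot *:%R lproj lproj_is_scalable.

End LmodQuotient.

Section QuotientMap.
Variables (A : nzRingType) (V : lmodType A) (N N' : submodClosed V).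
Hypothesis NN' : {subset (N : {pred V}) <= (N' : {pred V})}.

(* The natural map V / N -> V / N'; the inclusion is a phantom argument that
   keys the linear structure. *)
Definition lquot_map of {subset (N : {pred V}) <= (N' : {pred V})} :
  lquot N -> lquot N' := fun q => lproj N' (lrepr q).

Lemma lquot_map_lproj x : lquot_map NN' (lproj N x) = lproj N' x.
Proof.
by apply/eqP; rewrite lproj_eq NN' // -lproj_eq lreprK.
Qed.

Fact lquot_map_is_linear : linear (lquot_map NN').
Proof.
move=> a p q; rewrite -[p]lreprK -[q]lreprK -linearP !lquot_map_lproj.
exact: linearP.
Qed.

HB.instance Definition _ := GRing.isLinear.Build A (lquot N) (lquot N') _
  (lquot_map NN') lquot_map_is_linear.

End QuotientMap.

Section Coker.
Variables (A : nzRingType) (U V : lmodType A) (f : {linear U -> V}).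

Definition lrange : {pred V} := fun y => `[< exists x, y = f x >].

Fact lrange_submod_closed : submod_closed lrange.
Proof.
split; first by apply/asboolP; exists 0; rewrite linear0.
move=> a u w /asboolP[x ->] /asboolP[y ->].
by apply/asboolP; exists (a *: x + y); rewrite linearP.
Qed.

HB.instance Definition _ :=
  GRing.isSubmodClosed.Build A V lrange lrange_submod_closed.

Definition coker : lmodType A := lquot lrange.

End Coker.

Section DirectSum.
Variables (A : nzRingType) (I : finType) (M : I -> lmodType A).

Definition dsum : Type := {dffun forall i : I, M i}.

HB.instance Definition _ := Choice.on dsum.

Definition dsum_zero : dsum := [ffun i => 0].
Definition dsum_opp (x : dsum) : dsum := [ffun i => - x i].
Definition dsum_add (x y : dsum) : dsum := [ffun i => x i + y i].
Definition dsum_scale (a : A) (x : dsum) : dsum := [ffun i => a *: x i].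

Fact dsum_addA : associative dsum_add.
Proof. by move=> x y z; apply/ffunP => i; rewrite !ffunE addrA. Qed.
Fact dsum_addC : commutative dsum_add.
Proof. by move=> x y; apply/ffunP => i; rewrite !ffunE addrC. Qed.
Fact dsum_add0 : left_id dsum_zero dsum_add.
Proof. by move=> x; apply/ffunP => i; rewrite !ffunE add0r. Qed.
Fact dsum_addN : left_inverse dsum_zero dsum_opp dsum_add.
Proof. by move=> x; apply/ffunP => i; rewrite !ffunE addNr. Qed.

HB.instance Definition _ :=
  GRing.isZmodule.Build dsum dsum_addA dsum_addC dsum_add0 dsum_addN.

Fact dsum_scaleA a b x : dsum_scale a (dsum_scale b x) = dsum_scale (a * b) x.
Proof. by apply/ffunP => i; rewrite !ffunE scalerA. Qed.
Fact dsum_scale1 : left_id 1 dsum_scale.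
Proof. by move=> x; apply/ffunP => i; rewrite !ffunE scale1r. Qed.
Fact dsum_scaleDr : right_distributive dsum_scale +%R.
Proof. by move=> a x y; apply/ffunP => i; rewrite !ffunE scalerDr. Qed.
Fact dsum_scaleDl x : {morph dsum_scale^~ x : a b / a + b}.
Proof. by move=> a b; apply/ffunP => i; rewrite !ffunE scalerDl. Qed.

HB.instance Definition _ := GRing.Zmodule_isLmodule.Build A dsum
  dsum_scaleA dsum_scale1 dsum_scaleDr dsum_scaleDl.

Definition dinj (i : I) (y : M i) : dsum :=
  [ffun j => dfwith (fun j : I => 0 : M j) y j].

Fact dinj_is_linear i : linear (@dinj i).
Proof.
move=> a y z; apply/ffunP => j; rewrite !ffunE.
have [->|ji] := eqVneq j i; first by rewrite !dfwith_in.
by rewrite !dfwith_out ?scaler0 ?addr0 // eq_sym.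
Qed.

HB.instance Definition _ (i : I) :=
  GRing.isLinear.Build A (M i) dsum _ (@dinj i) (@dinj_is_linear i).

End DirectSum.

Arguments dinj {A I M} i y.

Section Gradings.
Local Open Scope classical_set_scope.

(* A grading is given by its homogeneous components. *)
Definition lquot_gr (A : nzRingType) (V : lmodType A) (G : nat -> set V)
    (N : submodClosed V) (d : nat) : set (lquot N) := lproj N @` G d.

Arguments lquot_gr {A V} G N d.

Definition coker_gr (A : nzRingType) (U V : lmodType A) (G : nat -> set V)
    (f : {linear U -> V}) : nat -> set (coker f) := lquot_gr G (lrange f).


Definition dsum_gr (A : nzRingType) (I : finType) (M : I -> lmodType A)
    (G : forall i, nat -> set (M i)) (d : nat) : set (dsum M) :=
  [set x | forall i, G i d (x i)].

Definition graded_iso (A : nzRingType) (U V : lmodType A)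
    (GU : nat -> set U) (GV : nat -> set V) : Prop :=
  exists f : {linear U -> V},
    bijective f /\ forall d x, GU d x <-> GV d (f x).

End Gradings.

Arguments lquot_gr {A V} G N d.
Arguments coker_gr {A U V} G f d.

Section Complexes.
Variables (R : realType) (k : nat).
Local Notation pt := 'rV[R]_k.

(* A simplex is given by its set of vertices. *)
Definition face := {fset pt}.

(* The convex hull of the vertices, i.e. the geometric realization. *)
Definition conv (g : face) : set pt := [set x | exists w : pt -> R,
  [/\ forall v, v \in g -> 0 <= w v, \sum_(v <- g) w v = 1
    & x = \sum_(v <- g) w v *: v]]%classic.

Definition aff (g : face) : set pt := [set x | exists2 w : pt -> R,
  \sum_(v <- g) w v = 1 & x = \sum_(v <- g) w v *: v]%classic.

Definition affine_independent (g : face) : Prop := forall w : pt -> R,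
  \sum_(v <- g) w v = 0 -> \sum_(v <- g) w v *: v = 0 ->
  forall v, v \in g -> w v = 0.

(* Finite geometric simplicial complexes in R^k; the empty face is excluded. *)
Record simplicial_complex (D : {fset face}) : Prop := SimplicialComplex {
  sc_nonempty : fset0 \notin D;
  sc_independent : forall g, g \in D -> affine_independent g;
  sc_closed : forall g d, g \in D -> d `<=` g -> d != fset0 -> d \in D;
  sc_meet : forall g d, g \in D -> d \in D ->
    (conv g `&` conv d)%classic = conv (g `&` d)
}.

Definition support (D : {fset face}) : set pt :=
  [set x | exists2 g, g \in D & conv g x]%classic.

Definition frontier (X : set pt) : set pt := (closure X `\` interior X)%classic.

(* The faces contained in the topological boundary of |D|. A k-dimensional
   simplex of R^k has nonempty interior, so all k-dimensional faces are
   interior. *)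
Definition boundary (D : {fset face}) : {fset face} :=
  [fset g in D | `[< (conv g `<=` frontier (support D))%classic >]].

Definition int_faces (D : {fset face}) : {fset face} := D `\` boundary D.

Definition dim_faces (i : nat) (D : {fset face}) : {fset face} :=
  [fset g in D | #|` g| == i.+1].

Definition simplex_complex (s : face) : {fset face} := fpowerset s `\ fset0.

(* D' is obtained from D by replacing the maximal cell s by D''. The faces of s
   that belong to other cells of D survive only as faces of D''; requiring D'
   to be a simplicial complex forces them not to be subdivided. *)
Record simple_subdivision (D : {fset face}) (s : face) (D'' D' : {fset face}) :
    Prop := SimpleSubdivision {
  ss_complex : simplicial_complex D;
  ss_cell : s \in dim_faces k D;
  ss_subdivision : simplicial_complex D'' /\ support D'' = conv s;
  ss_boundary : int_faces D `&` boundary (simplex_complex s)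
              = int_faces D `&` boundary D'';
  ss_replace : D' = [fset g in D | ~~ (g `<=` s)] `|` D'';
  ss_complex' : simplicial_complex D'
}.

Lemma mem_boundary D g : (g \in boundary D) =
  (g \in D) && `[< (conv g `<=` frontier (support D))%classic >].
Proof. by rewrite /boundary !inE. Qed.

Lemma mem_int_faces D g : (g \in int_faces D) =
  (g \in D) && ~~ `[< (conv g `<=` frontier (support D))%classic >].
Proof.
rewrite /int_faces in_fsetD mem_boundary.
by case: (g \in D); rewrite /= ?andbT ?andbF.
Qed.

Lemma mem_dim_faces i D g :
  (g \in dim_faces i D) = (g \in D) && (#|` g| == i.+1).
Proof. by rewrite /dim_faces !inE. Qed.

Lemma conv_sub (g d : face) : g `<=` d -> (conv g `<=` conv d)%classic.
Proof.
move=> gd x [w [w0 w1 ->]].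
exists (fun v => if v \in g then w v else 0).
have e v : v \in d -> v \notin g -> (if v \in g then w v else 0) = 0.
  by move=> _ /negbTE ->.
split.
- by move=> v _; case: ifP => // /w0.
- rewrite -(big_fset_incl _ gd e) -w1 big_seq [RHS]big_seq.
  by apply: eq_bigr => v ->.
- rewrite -(big_fset_incl _ gd) => [|v vd /(e v vd) ->]; last exact: scale0r.
  by rewrite big_seq [RHS]big_seq; apply: eq_bigr => v ->.
Qed.

Lemma support_simplex_complex (s : face) : support (simplex_complex s) = conv s.
Proof.
apply/seteqP; split => x.
  by move=> [g]; rewrite !inE fpowersetE => /andP[_ gs]; exact: conv_sub.
move=> xs; exists s => //; rewrite !inE fpowersetE fsubset_refl andbT.
apply/eqP => s0; move: xs; rewrite s0 => -[w [_]].
by rewrite big_seq_fset0 => /eqP; rewrite eq_sym oner_eq0.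
Qed.

Lemma proper_face_boundary (s g : face) : affine_independent s ->
  g != fset0 -> g `<` s -> g \in boundary (simplex_complex s).
Proof.
move=> sI g0 gs; rewrite !inE fpowersetE g0 fproper_sub //=.
apply/asboolP; rewrite support_simplex_complex => x xg.
have xs : conv s x by exact: conv_sub (fproper_sub gs) _ xg.
split; first exact: subset_closure.
move: gs; rewrite fproperE => /andP[gs /fsubsetPn[v vs vg]].
move=> /nbhs_ballP[e /= e0 es].
case: xg => w [w0 w1 xE].
pose m : R := \sum_(j < k) `|x 0 j - v 0 j|.
have m0 : 0 <= m by apply: sumr_ge0.
pose t : R := e / (1 + m).
have m1 : 0 < 1 + m by rewrite ltr_pwDl.
have t0 : 0 < t by rewrite divr_gt0.
have /es[u [u0 u1]] : ball x e (x + t *: (x - v)).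
  split=> // i j; rewrite /ball /= !mxE ord1 opprD addrA subrr add0r normrN.
  rewrite normrM gtr0_norm // /t mulrAC ltr_pdivrMr // ltr_pM2l //.
  rewrite (le_lt_trans (_ : _ <= m)) // ?ltrDr //.
  by rewrite /m (bigD1 j) //= lerDl sumr_ge0.
pose w' z := if z \in g then w z else 0.
have e1 z : z \in s -> z \notin g -> w' z = 0.
  by rewrite /w' => _ /negbTE ->.
have w'1 : \sum_(z <- s) w' z = 1.
  rewrite -(big_fset_incl _ gs e1) -w1 big_seq [RHS]big_seq.
  by apply: eq_bigr => z zg; rewrite /w' zg.
have w'x : \sum_(z <- s) w' z *: z = x.
  rewrite -(big_fset_incl _ gs) => [|z zs /(e1 z zs) ->]; last exact: scale0r.
  by rewrite xE big_seq [RHS]big_seq; apply: eq_bigr => z zg; rewrite /w' zg.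
pose d z : R := (z == v)%:R.
have d1 : \sum_(z <- s) d z = 1.
  rewrite (big_fsetD1 v) //= /d eqxx big1_fset ?addr0 // => z.
  by rewrite !inE => /andP[/negbTE -> _] _.
have dv : \sum_(z <- s) d z *: z = v.
  rewrite (big_fsetD1 v) //= /d eqxx scale1r big1_fset ?addr0 // => z.
  by rewrite !inE => /andP[/negbTE -> _] _; rewrite scale0r.
move=> uE.
have := sI (fun z => u z - (1 + t) * w' z + t * d z).
rewrite !big_split /= sumrN -!mulr_sumr u1 w'1 d1 !mulr1.
rewrite opprD addrA subrr add0r addrC subrr => /(_ erefl).
have -> : \sum_(z <- s) (u z - (1 + t) * w' z + t * d z) *: z = 0.
  under eq_bigr do rewrite !scalerDl scaleNr -!scalerA.
  rewrite !big_split /= sumrN -!scaler_sumr -uE w'x dv.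
  rewrite scalerBr scalerDl scale1r.
  rewrite [X in X - _ + _]addrA [X in X + _]addrAC subrr scalerA.
  by rewrite sub0r addNr.
move=> /(_ erefl v vs); rewrite /w' (negbTE vg) mulr0 subr0 /d eqxx mulr1.
by move=> /eqP; rewrite gt_eqF // ltr_wpDl // u0.
Qed.

Lemma simple_subdivision_not_subdivided D s D'' D' g :
  simple_subdivision D s D'' D' -> g \in int_faces D -> g `<` s -> g \in D''.
Proof.
move=> H gD gs; have [cD sD _ bE _ _] := H.
have g0 : g != fset0.
  apply: contraTneq gD => ->.
  by rewrite mem_int_faces (negbTE (sc_nonempty cD)).
have sI : affine_independent s.
  by apply: (sc_independent cD); move: sD; rewrite mem_dim_faces => /andP[].
have: g \in int_faces D `&` boundary (simplex_complex s).
  by rewrite in_fsetI gD proper_face_boundary.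
by rewrite bE in_fsetI mem_boundary => /and3P[].
Qed.

Lemma simple_subdivision_mem D s D'' D' g : simple_subdivision D s D'' D' ->
  g \in int_faces D -> g != s -> g \in D'.
Proof.
move=> H gD gs; rewrite (ss_replace H) in_fsetU.
have [gsub|gsub] := boolP (g `<=` s); last first.
  by rewrite !inE gsub; move: gD; rewrite mem_int_faces => /andP[->].
by rewrite (simple_subdivision_not_subdivided H) ?orbT // fproperEneq gs.
Qed.

Lemma simple_subdivision_support D s D'' D' :
  simple_subdivision D s D'' D' -> support D' = support D.
Proof.
move=> H; have [cD sD [_ sE] _ -> _] := H.
have sD0 : s \in D by move: sD; rewrite mem_dim_faces => /andP[].
apply/seteqP; split => x.
  move=> [g]; rewrite in_fsetU => /orP[gD|gD''] xg.
    by move: gD; rewrite !inE => /andP[gD _]; exists g.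
  by exists s => //; rewrite -sE; exists g.
move=> [g gD xg]; have [gs|gs] := boolP (g `<=` s); last first.
  by exists g => //; rewrite !inE gD gs.
have : support D'' x by rewrite sE; exact: conv_sub xg.
by move=> [d dD xd]; exists d => //; rewrite in_fsetU dD orbT.
Qed.

Lemma simple_subdivision_int_faces D s D'' D' i :
  simple_subdivision D s D'' D' -> (i < k)%N ->
  dim_faces i (int_faces D) `<=` dim_faces i (int_faces D').
Proof.
move=> H ik; apply/fsubsetP => g.
rewrite !mem_dim_faces => /andP[gD gi].
have gs : g != s.
  apply: contraTneq gi => ->; move: (ss_cell H).
  by rewrite mem_dim_faces => /andP[_ /eqP ->]; rewrite eqSS gtn_eqF.
have gD' := simple_subdivision_mem H gD gs.
move: gD; rewrite !mem_int_faces (simple_subdivision_support H).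
by move=> /andP[_ ->]; rewrite gD' gi.
Qed.

End Complexes.

Section SplineComplex.
Variables (R : realType) (k : nat).
Local Notation P := (mpoly k.+1 R).

(* The homogenization c x_0 + a_1 x_1 + ... + a_k x_k of the affine form
   c + a_1 x_1 + ... + a_k x_k. *)
Definition homog_form (c : R) (a : 'rV[R]_k) : P :=
  c *: mpolyX R (mnm1 ord0)
  + \sum_(j < k) a 0 j *: mpolyX R (mnm1 (lift ord0 j)).

(* p is the homogenization of an affine form cutting out the affine span
   of t. *)
Definition spans_face (t : face R k) (p : P) : Prop := exists c a,
  p = homog_form c a /\
  aff t = [set x | c + \sum_(j < k) a 0 j * x 0 j = 0]%classic.

Variables (r : nat) (ell : face R k -> P).

(* The ideal generated by the (r+1)-st powers of the forms ell t, for t a face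
   of dimension k-1 (that is, with k vertices) containing g. *)
Definition J (D : {fset face R k}) (g : face R k) : {pred P^o} :=
  fun f => `[< exists h : face R k -> P,
    f = \sum_(t <- [fset t in D | (#|` t| == k) && (g `<=` t)])
          h t * ell t ^+ r.+1 >].

Fact J_submod_closed D g : submod_closed (J D g).
Proof.
split.
  apply/asboolP; exists (fun=> 0).
  by rewrite big1 // => t _; rewrite mul0r.
move=> a u v /asboolP[h ->] /asboolP[h' ->].
apply/asboolP; exists (fun t => a * h t + h' t).
rewrite /GRing.scale /= mulr_sumr -big_split /=.
by apply: eq_bigr => t _; rewrite mulrDl mulrA.
Qed.

HB.instance Definition _ D g :=
  GRing.isSubmodClosed.Build P P^o (J D g) (J_submod_closed D g).

(* The terms of the complex R/J(D), in degree k and in degrees i < k; its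
   differentials are not needed. *)
Definition RJ_top (D : {fset face R k}) : lmodType P :=
  dsum (fun _ : dim_faces k D => P^o : lmodType P).

Definition RJ (D : {fset face R k}) (i : nat) : lmodType P :=
  dsum (fun g : dim_faces i (int_faces D) => lquot (J D (val g)) : lmodType P).

Definition P_gr (d : nat) : set P^o := [set f | f \is ishomog1 d mdeg]%classic.

Definition RJ_top_gr (D : {fset face R k}) : nat -> set (RJ_top D) :=
  dsum_gr (fun _ => P_gr).

Definition RJ_gr (D : {fset face R k}) (i : nat) : nat -> set (RJ D i) :=
  dsum_gr (fun g => lquot_gr P_gr (J D (val g))).

Definition diag (D : {fset face R k}) (f : P^o) : RJ_top D :=
  \sum_(g : dim_faces k D) dinj g f.

Fact diag_is_linear D : linear (@diag D).
Proof.
move=> a x y; rewrite /diag scaler_sumr -big_split /=.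
by apply: eq_bigr => g _; rewrite -linearP.
Qed.

HB.instance Definition _ D :=
  GRing.isLinear.Build P P^o (RJ_top D) _ (@diag D) (@diag_is_linear D).

Definition split_subdivision (D : {fset face R k}) (s : face R k)
    (D'' D' : {fset face R k}) : Prop :=
  simple_subdivision D s D'' D' /\
  forall g, g \in boundary D'' -> g \notin boundary D' -> J D' g =i J D g.

Section Tautological.
Variables (D : {fset face R k}) (s : face R k) (D'' D' : {fset face R k}).

(* The components of the tautological chain map, in degree k and in degrees
   i < k. In degree k the generator of g goes to the sum of the generators of
   the cells g' of D' that lie in g. *)
Definition taut_top (x : RJ_top D) : RJ_top D' :=
  \sum_(g : dim_faces k D)
    \sum_(g' : dim_faces k D' | `[< conv (val g') `<=` conv (val g) >]%classic)
      dinj g' (x g).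

Fact taut_top_is_linear : linear taut_top.
Proof.
move=> a x y; rewrite /taut_top scaler_sumr -big_split /=.
apply: eq_bigr => g _; rewrite scaler_sumr -big_split /=.
by apply: eq_bigr => g' _; rewrite -linearP !ffunE.
Qed.

HB.instance Definition _ := GRing.isLinear.Build P (RJ_top D) (RJ_top D') _
  taut_top taut_top_is_linear.

Variables (H : simple_subdivision D s D'' D') (i : nat) (ik : (i < k)%N).

Lemma J_sub g : g \in dim_faces i (int_faces D) ->
  {subset J D g <= J D' g}.
Proof.
rewrite mem_dim_faces mem_int_faces => /andP[/andP[gD gb] _] f.
move=> /asboolP[h ->]; apply/asboolP.
pose A := [fset t in D | (#|` t| == k) && (g `<=` t)].
exists (fun t => if t \in A then h t else 0).
transitivity (\sum_(t <- A) (if t \in A then h t else 0) * ell t ^+ r.+1).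
  by rewrite big_seq [RHS]big_seq; apply: eq_bigr => t ->.
apply: big_fset_incl => [|t _ /negbTE ->]; last by rewrite mul0r.
apply/fsubsetP => t; rewrite !inE /= => /and3P[tD tk gt].
rewrite tk gt !andbT; apply: (simple_subdivision_mem H).
  rewrite mem_int_faces tD; apply: contra gb => /asboolP tb.
  by apply/asboolP => x /(conv_sub gt) /tb.
apply: contraTneq tk => ->; move: (ss_cell H).
by rewrite mem_dim_faces => /andP[_ /eqP ->]; rewrite gtn_eqF.
Qed.

Definition taut (x : RJ D i) : RJ D' i :=
  \sum_(g : dim_faces i (int_faces D))
    dinj (fincl (simple_subdivision_int_faces H ik) g)
      (lquot_map (J_sub (valP g)) (x g)).

Fact taut_is_linear : linear taut.
Proof.
move=> a x y; rewrite /taut scaler_sumr -big_split /=.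
by apply: eq_bigr => g _; rewrite -!linearP !ffunE.
Qed.

HB.instance Definition _ := GRing.isLinear.Build P (RJ D i) (RJ D' i) _
  taut taut_is_linear.

End Tautological.
End SplineComplex.

Arguments RJ_gr {R k} r ell D i d.
Arguments RJ_top_gr {R k} D d.
Arguments taut_top {R k} D D' x.
Arguments taut {R k} r ell {D s D'' D'} H {i} ik x.
Arguments diag {R k} D f.

(* Main.v *)
Require Import Defs.
From HB Require Import structures.
From mathcomp Require Import all_boot all_order all_algebra.
From mathcomp Require Import finmap generic_quotient ring_quotient.
From mathcomp Require Import boolp classical_sets functions reals topology.
From mathcomp Require Import normedtype.
From mathcomp Require Import -(notations) mpoly.

Set Implicit Arguments.
Unset Strict Implicit.
Unset Printing Implicit Defensive.

Import Order.TTheory GRing.Theory Num.Theory.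
Import numFieldNormedType.Exports.
Local Open Scope fset_scope.
Local Open Scope ring_scope.

(** Both cokernels are computed face by face.

    Below degree k, the interior i-faces of D' are the disjoint union of those
    of D and those of D''.  On the summand of an interior face g of D the map
    v_i is the quotient map R/J(D)_g -> R/J(D')_g, which is surjective, and it
    lands in no other summand; so the cokernel is the sum of the R/J(D')_g over
    the interior faces g of D'' ([graded_iso_coker_dsum]).  Such a g meets the
    interior of |s|, hence every face of D' containing it already belongs to
    D'', and J(D')_g = J(D'')_g ([J_subdivision]).

    The decomposition of the interior faces rests on two geometric facts.
    - A face of D that does not contain s misses the interior of |s|
      ([face_avoids_interior]): so an interior face of D'' of dimension less
      than k is not a face of D.
    - A face g of D'' inside the frontier of |s| lies in a facet t of s
      ([conv_facet]).  If g is interior in D', then t is interior in D, so t is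
      itself a face of D''; two faces of one complex with |g| inside |t| satisfy
      g <= t, so g is a face of D ([int_faces_split]).

    In degree k, the k-cells of D' are those of D'' and the k-cells of D other
    than s.  The map v_k is the identity on the latter, and sends the generator
    of s to the sum of the generators of the cells of D''.  So restriction to
    the cells of D'' identifies the cokernel with the quotient by the diagonal
    ([graded_iso_coker_taut_top]). *)

(** * Direct sums, quotients and cokernels of graded modules *)

Lemma dinj_in (A : nzRingType) (I : finType) (M : I -> lmodType A) (i : I)
  (y : M i) : (dinj i y : dsum M) i = y.
Proof. by rewrite ffunE dfwith_in. Qed.

Lemma dinj_out (A : nzRingType) (I : finType) (M : I -> lmodType A) (i j : I)
  (y : M i) : i != j -> (dinj i y : dsum M) j = 0.
Proof. by move=> ij; rewrite ffunE dfwith_out. Qed.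

Lemma dsum_sumE (A : nzRingType) (I : finType) (M : I -> lmodType A)
  (L : finType) (Q : pred L) (F : L -> dsum M) (i : I) :
  (\sum_(l | Q l) F l : dsum M) i = \sum_(l | Q l) F l i.
Proof.
by apply: (big_morph (fun x : dsum M => x i)) => [x y|]; rewrite ffunE.
Qed.

Lemma sum_dinj_in (A : nzRingType) (I L : finType) (M : I -> lmodType A)
  (b : L -> I) (y : forall l, M (b l)) (l : L) : injective b ->
  (\sum_l dinj (b l) (y l) : dsum M) (b l) = y l.
Proof.
move=> b_inj; rewrite dsum_sumE (bigD1 l) //= dinj_in big1 ?addr0 // => m ml.
by rewrite dinj_out // (inj_eq b_inj).
Qed.

Lemma sum_dinj_out (A : nzRingType) (I L : finType) (M : I -> lmodType A)
  (b : L -> I) (y : forall l, M (b l)) (i : I) : (forall l, b l != i) ->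
  (\sum_l dinj (b l) (y l) : dsum M) i = 0.
Proof. by move=> bi; rewrite dsum_sumE big1 // => l _; rewrite dinj_out. Qed.

Section FirstIsomorphism.
Variables (A : nzRingType) (U V W : lmodType A).
Variables (f : {linear U -> V}) (phi : {linear V -> W}).
Variables (GV : nat -> set V) (GW : nat -> set W).
Hypothesis ker_phi : forall v, phi v = 0 <-> exists u, v = f u.

Let phibar (q : coker f) : W := phi (lrepr q).

Let phibar_lproj v : phibar (lproj (lrange f) v) = phi v.
Proof.
apply/eqP; rewrite -subr_eq0 -linearB; apply/eqP/ker_phi/asboolP.
by move: (lreprK (lproj (lrange f) v)) => /eqP; rewrite lproj_eq.
Qed.

Let phibar_linear : linear phibar.
Proof.
move=> a p q; rewrite -[p]lreprK -[q]lreprK -linearP !phibar_lproj.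
exact: linearP.
Qed.

HB.instance Definition _ := GRing.isLinear.Build A (coker f) W _ phibar
  phibar_linear.

Let phibar_inj : injective phibar.
Proof.
move=> p q; rewrite -[p]lreprK -[q]lreprK !phibar_lproj => /eqP.
rewrite -subr_eq0 -linearB => /eqP/ker_phi/asboolP pq.
by apply/eqP; rewrite lproj_eq.
Qed.

(** The first isomorphism theorem.  The induced bijection respects the gradings
    in both directions only if homogeneous elements of the target have
    homogeneous lifts of the same degree, hence the last hypothesis. *)
Lemma graded_iso_coker :
  (forall w, exists v, phi v = w) ->
  (forall d v, GV d v -> GW d (phi v)) ->
  (forall d w, GW d w -> exists2 v, GV d v & phi v = w) ->
  graded_iso (coker_gr GV f) GW.
Proof.
move=> /choice[s sK] phiG liftG; exists phibar; split.
  exists (fun w => lproj (lrange f) (s w)) => [q|w]; last first.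
    by rewrite /= phibar_lproj sK.
  by apply: phibar_inj; rewrite /= phibar_lproj sK.
move=> d q; split=> [[v vd <-]|/liftG[v vd vq]].
  by rewrite /= phibar_lproj; apply: phiG.
by exists v => //; apply: phibar_inj; rewrite /= phibar_lproj.
Qed.

End FirstIsomorphism.

Lemma graded_iso_lquot (A : nzRingType) (V : lmodType A) (G : nat -> set V)
  (N N' : submodClosed V) : (N : {pred V}) =i (N' : {pred V}) ->
  graded_iso (lquot_gr G N) (lquot_gr G N').
Proof.
move=> e.
have NN' : {subset (N : {pred V}) <= (N' : {pred V})} by move=> x; rewrite e.
have N'N : {subset (N' : {pred V}) <= (N : {pred V})} by move=> x; rewrite e.
exists (lquot_map NN' : {linear _ -> _}); split.
  by exists (lquot_map N'N) => q; rewrite /= -[q]lreprK !lquot_map_lproj.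
move=> d q; split=> -[v vd].
  by move=> <-; exists v => //; rewrite /= lquot_map_lproj.
rewrite -[q]lreprK /= lquot_map_lproj => /eqP; rewrite lproj_eq -e => vq.
by exists v => //; apply/eqP; rewrite lproj_eq.
Qed.

Section CokernelOfDirectSum.
Variables (A : nzRingType) (I K L : finType).
Variables (M : I -> lmodType A) (M' : K -> lmodType A) (M'' : L -> lmodType A).
Variables (G' : forall j, nat -> set (M' j)).
Variables (G'' : forall l, nat -> set (M'' l)).
Arguments G' : clear implicits.
Arguments G'' : clear implicits.
Variables (a : I -> K) (b : L -> K).
Hypotheses (a_inj : injective a) (b_inj : injective b).
Hypothesis disj : forall i l, a i != b l.
Hypothesis cover : forall j, (exists i, a i = j) \/ (exists l, b l = j).
Variables (u : forall i, M i -> M' (a i)) (f : {linear dsum M -> dsum M'}).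
Arguments u : clear implicits.
Hypothesis u_surj : forall i (y : M' (a i)), exists x, u i x = y.
Hypothesis fE : forall x, f x = \sum_i dinj (a i) (u i (x i)).
Hypothesis G'0 : forall j d, G' j d 0.
Variable e : forall l, {linear M' (b l) -> M'' l}.
Hypothesis e_bij : forall l, bijective (e l).
Hypothesis e_gr : forall l d x, G' (b l) d x <-> G'' l d (e l x).

Let phi (x : dsum M') : dsum M'' := [ffun l => e l (x (b l))].

Let phi_linear : linear phi.
Proof. by move=> c x y; apply/ffunP => l; rewrite !ffunE linearP. Qed.

HB.instance Definition _ := GRing.isLinear.Build A (dsum M') (dsum M'') _ phi
  phi_linear.

Lemma graded_iso_coker_dsum_of :
  graded_iso (coker_gr (dsum_gr G') f) (dsum_gr G'').
Proof.
have inv_e l : exists g, cancel (e l) g /\ cancel g (e l).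
  by have [g eK gK] := e_bij l; exists g.
pose e' l := sval (cid (inv_e l)).
have e'K l : cancel (e l) (e' l) /\ cancel (e' l) (e l) := svalP (cid (inv_e l)).
pose s (w : dsum M'') : dsum M' := \sum_l dinj (b l) (e' l (w l)).
have sK w : phi (s w) = w.
  apply/ffunP => l; rewrite ffunE sum_dinj_in //.
  by have [_ ->] := e'K l.
apply: (@graded_iso_coker _ _ _ _ f phi) => [v|w|d v vd l|d w wd].
- split=> [v0|[x ->]]; last first.
    by apply/ffunP => l; rewrite !ffunE fE sum_dinj_out ?linear0.
  pose x i := sval (cid (@u_surj i (v (a i)))).
  have xE i : u i (x i) = v (a i) := svalP (cid (@u_surj i (v (a i)))).
  exists [ffun i => x i]; apply/ffunP => j; rewrite fE.
  have [[i <-]|[l <-]] := cover j; first by rewrite sum_dinj_in // ffunE xE.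
  rewrite sum_dinj_out //.
  have [eK _] := e'K l; apply: (can_inj eK); rewrite linear0.
  by have := congr1 (fun w : dsum M'' => w l) v0; rewrite !ffunE.
- by exists (s w).
- by rewrite ffunE -e_gr; apply: vd.
- exists (s w) => // j.
  have [[i <-]|[l <-]] := cover j.
    by rewrite sum_dinj_out // => l; rewrite eq_sym.
  rewrite sum_dinj_in // e_gr; have [_ ->] := e'K l; exact: wd.
Qed.

End CokernelOfDirectSum.

(** If the summands of the target are indexed by a disjoint union of [a @: I]
    and [b @: L], and [f] maps the summand [i] onto the summand [a i], then only
    the summands indexed by [L] survive in the cokernel. *)
Lemma graded_iso_coker_dsum (A : nzRingType) (I K L : finType)
  (M : I -> lmodType A) (M' : K -> lmodType A) (M'' : L -> lmodType A)
  (G' : forall j, nat -> set (M' j)) (G'' : forall l, nat -> set (M'' l))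
  (a : I -> K) (b : L -> K) (u : forall i, M i -> M' (a i))
  (f : {linear dsum M -> dsum M'}) :
  injective a -> injective b -> (forall i l, a i != b l) ->
  (forall j, (exists i, a i = j) \/ (exists l, b l = j)) ->
  (forall i (y : M' (a i)), exists x, u i x = y) ->
  (forall x, f x = \sum_i dinj (a i) (u i (x i))) ->
  (forall j d, G' j d 0) ->
  (forall l, graded_iso (G' (b l)) (G'' l)) ->
  graded_iso (coker_gr (dsum_gr G') f) (dsum_gr G'').
Proof.
move=> a_inj b_inj disj cover u_surj fE G'0 e_ex.
pose e l := sval (cid (e_ex l)).
have eP l := svalP (cid (e_ex l)).
by apply: (@graded_iso_coker_dsum_of _ _ _ _ _ _ _ _ _ a b _ _ _ _ u _ _ _ _ e)
  => // l; have [] := eP l.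
Qed.
(** * Simplices and their homogeneous coordinates *)

Section HomogeneousCoordinates.
Variables (R : realType) (k : nat).
Implicit Types (g h s : face R k) (x : 'rV[R]_k).

(** Passing from x to (1, x) turns affine combinations into linear ones, so that
    affine independence of the vertices of g becomes linear independence of the
    rows of [vertex_mx g]. *)
Definition homog_pt x : 'rV[R]_(1 + k) := row_mx 1%:M x.

Definition vertex_mx g : 'M[R]_(#|{: g}|, 1 + k) :=
  \matrix_(i < #|{: g}|) homog_pt (val (enum_val i)).

Lemma sum_fsetE (V : nmodType) g (F : 'rV[R]_k -> V) :
  \sum_(v <- g) F v = \sum_(i < #|{: g}|) F (val (enum_val i)).
Proof.
rewrite big_seq_fsetE /=.
by rewrite -(big_enum_val (A := {: g}) (fun v => F (val v))).
Qed.

Lemma mulmx_vertex g (u : 'rV[R]_#|{: g}|) : u *m vertex_mx g =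
  row_mx (\sum_i u 0 i)%:M (\sum_i u 0 i *: val (enum_val i)).
Proof.
rewrite mulmx_sum_row; under eq_bigr do rewrite rowK scale_row_mx.
transitivity (row_mx (\sum_i u 0 i *: (1%:M : 'M[R]_1))
                     (\sum_i u 0 i *: val (enum_val i))).
  by apply: (big_ind3 (fun a b c => a = row_mx b c)) => [|? ? ? ? ? ? -> ->|//];
    rewrite ?row_mx0 ?add_row_mx.
by rewrite -scaler_suml scale_scalar_mx mulr1.
Qed.

(** The weights in [conv] and [affine_independent] are functions on all of
    space; this extends by zero a row vector of coefficients on the vertices. *)
Definition weight_of g (u : 'rV[R]_#|{: g}|) (v : 'rV[R]_k) : R :=
  if insub v is Some v' then u 0 (enum_rank v') else 0.

Lemma weight_ofE g (u : 'rV[R]_#|{: g}|) i :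
  weight_of u (val (enum_val i)) = u 0 i.
Proof. by rewrite /weight_of valK enum_valK. Qed.

Lemma weight_of_sum g (u : 'rV[R]_#|{: g}|) : u *m vertex_mx g =
  row_mx (\sum_(v <- g) weight_of u v)%:M (\sum_(v <- g) weight_of u v *: v).
Proof.
rewrite mulmx_vertex !sum_fsetE.
by congr (row_mx _%:M _); apply: eq_bigr => i _; rewrite weight_ofE.
Qed.

Lemma vertex_mx_free g : affine_independent g -> row_free (vertex_mx g).
Proof.
move=> gI; apply: inj_row_free => u; rewrite weight_of_sum -row_mx0.
move=> /eq_row_mx[/matrixP/(_ 0 0) + u0]; rewrite !mxE eqxx mulr1n => u1.
apply/rowP => i; rewrite mxE -weight_ofE.
by apply: gI; rewrite ?u1 //; apply: valP.
Qed.

Lemma conv_homog g x : conv g x -> (homog_pt x <= vertex_mx g)%MS.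
Proof.
move=> [w [_ w1 ->]]; apply/submxP; exists (\row_i w (val (enum_val i))).
rewrite mulmx_vertex /homog_pt -w1 !sum_fsetE.
by congr (row_mx _%:M _); apply: eq_bigr => i _; rewrite mxE.
Qed.

Lemma conv_vertex g v : v \in g -> conv g v.
Proof.
move=> vg; exists (fun u => (u == v)%:R); split=> [u _||].
- exact: ler0n.
- rewrite (big_fsetD1 v) //= eqxx big1_fset ?addr0 // => u.
  by rewrite !inE => /andP[/negbTE -> _].
- rewrite (big_fsetD1 v) //= eqxx scale1r big1_fset ?addr0 // => u.
  by rewrite !inE => /andP[/negbTE -> _] _; rewrite scale0r.
Qed.

Lemma conv_sub_vertices g h : (forall v, v \in g -> conv h v) ->
  (conv g `<=` conv h)%classic.
Proof.
move=> gh x [c [c0 c1 ->]].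
have /choice[w wP] : forall v, exists w : 'rV[R]_k -> R, v \in g ->
    [/\ forall u, u \in h -> 0 <= w u, \sum_(u <- h) w u = 1
      & v = \sum_(u <- h) w u *: u].
  move=> v; case: (boolP (v \in g)) => [/gh[w wE]|_]; first by exists w.
  by exists (fun=> 0).
exists (fun u => \sum_(v <- g) c v * w v u); split.
- move=> u uh; rewrite big_seq; apply: sumr_ge0 => v vg.
  by rewrite mulr_ge0 ?c0 //; have [-> //] := wP v vg.
- rewrite exchange_big -c1 /= big_seq [RHS]big_seq; apply: eq_bigr => v vg.
  by rewrite -mulr_sumr; have [_ -> _] := wP v vg; rewrite mulr1.
- under [RHS]eq_bigr do rewrite scaler_suml.
  rewrite exchange_big /= big_seq [RHS]big_seq; apply: eq_bigr => v vg.
  have [_ _ vE] := wP v vg.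
  transitivity (c v *: \sum_(u <- h) w v u *: u); first by rewrite -vE.
  rewrite scaler_sumr.
  by apply: eq_bigr => u _; rewrite scalerA.
Qed.

Lemma conv_fset0 x : ~ conv fset0 x.
Proof.
by move=> [w [_]]; rewrite big_seq_fset0 => /eqP; rewrite eq_sym oner_eq0.
Qed.

(** The row space of [vertex_mx g] has dimension #|g| and is contained in that
    of [vertex_mx h]. *)
Lemma card_conv_sub g h : affine_independent g -> (conv g `<=` conv h)%classic ->
  (#|` g| <= #|` h|)%N.
Proof.
move=> /vertex_mx_free /eqP gI gh; rewrite !cardfE -gI.
apply: leq_trans (rank_leq_row (vertex_mx h)); apply: mxrankS.
by apply/row_subP => i; rewrite rowK; apply/conv_homog/gh/conv_vertex/valP.
Qed.

Lemma homog_mul_continuous n (P : 'M[R]_(1 + k, n)) i :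
  continuous (fun x => (homog_pt x *m P) 0 i).
Proof.
have -> : (fun y => (homog_pt y *m P) 0 i) =
  (fun y => (1%:M *m usubmx P) 0 i + \sum_(j < k) y 0 j * dsubmx P j i).
  apply/funext => y; rewrite /homog_pt -{1}[P]vsubmxK mul_row_col mxE.
  by rewrite [X in _ + X]mxE.
move=> x.
apply: (@cvgD _ _ _ (nbhs x) _ _ _ _ _ (cvg_cst _ (FF := nbhs_filter x))).
apply: (@cvg_big _ _ _ _ _ add_continuous _ (nbhs x) _ _ _ _) => j _.
apply: (@cvgMr_tmp _ _ (nbhs x)); exact: (@coord_continuous R 1 k 0 j x).
Qed.

(** The barycentric coordinates of a full-dimensional simplex are continuous
    functions on the whole space, so they stay positive near a point where they
    all are. *)
Lemma conv_interior s (w : 'rV[R]_k -> R) : affine_independent s ->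
  #|` s| = k.+1 -> (forall v, v \in s -> 0 < w v) -> \sum_(v <- s) w v = 1 ->
  interior (conv s) (\sum_(v <- s) w v *: v).
Proof.
move=> sI sk w0 w1; set x := \sum_(v <- s) _.
pose c (y : 'rV[R]_k) := homog_pt y *m pinvmx (vertex_mx s).
have sfree := vertex_mx_free sI.
have cK y : c y *m vertex_mx s = homog_pt y.
  apply/mulmxKpV/submx_full; rewrite /row_full.
  by move: sfree; rewrite /row_free => /eqP ->; rewrite -cardfE sk.
have cx i : c x 0 i = w (val (enum_val i)).
  have -> : c x = \row_i w (val (enum_val i)); last by rewrite mxE.
  apply: (row_free_inj sfree); rewrite cK mulmx_vertex /homog_pt -w1 !sum_fsetE.
  by congr (row_mx _%:M _); [|rewrite /x sum_fsetE];
    apply: eq_bigr => j _; rewrite mxE.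
have : (\forall y \near x, forall i, 0 < c y 0 i)%classic.
  apply: (@filter_forall _ _ _ (nbhs x)) => i.
  apply: (@cvgr_gt _ _ (nbhs x) _ _ (c x 0 i)).
    exact: homog_mul_continuous.
  by rewrite cx; apply/w0/valP.
apply: filterS => y y0; exists (weight_of (c y)).
have := cK y; rewrite weight_of_sum => /eq_row_mx[/matrixP/(_ 0 0)].
rewrite !mxE eqxx !mulr1n => y1 yE; split => // v vs.
by rewrite /weight_of insubT ltW.
Qed.

(** The barycenter of g is not interior to |s|, so its barycentric coordinate
    at some vertex u of s vanishes.  This coordinate is the average of the
    nonnegative coordinates at u of the vertices of g, which therefore all
    vanish. *)
Lemma conv_facet s (g : face R k) : affine_independent s -> #|` s| = k.+1 ->
  g != fset0 -> (conv g `<=` conv s)%classic ->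
  (conv g `<=` frontier (conv s))%classic ->
  exists2 u, u \in s & (conv g `<=` conv (s `\ u)%fset)%classic.
Proof.
move=> sI sk g0 gs gF.
have /choice[w wP] : forall v, exists w : 'rV[R]_k -> R, v \in g ->
    [/\ forall u, u \in s -> 0 <= w u, \sum_(u <- s) w u = 1
      & v = \sum_(u <- s) w u *: u].
  move=> v; case: (boolP (v \in g)) => [/conv_vertex/gs[w wE]|_].
    by exists w.
  by exists (fun=> 0).
pose n : R := #|` g|%:R.
have n0 : 0 < n by rewrite ltr0n cardfs_gt0.
have nV : \sum_(v <- g) n^-1 = 1.
  rewrite big_const_seq count_predT iter_addr_0 -[X in X *+ _]mulr1.
  by rewrite -mulrnAr mulVf // gt_eqF.
(* the barycentric coordinates of the barycenter of g *)
pose wb u := \sum_(v <- g) n^-1 * w v u.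
have wb1 : \sum_(u <- s) wb u = 1.
  rewrite exchange_big /= big_seq (eq_bigr (fun=> n^-1)); last first.
    by move=> v vg; rewrite -mulr_sumr; have [_ -> _] := wP v vg; rewrite mulr1.
  by rewrite -big_seq.
have [|] := pselect (exists2 u, u \in s & wb u <= 0); last first.
  move=> wb_gt0.
  have : conv g (\sum_(u <- s) wb u *: u).
    exists (fun=> n^-1); split.
    - by move=> v _; rewrite invr_ge0 ltW.
    - exact: nV.
    - under eq_bigr do rewrite scaler_suml.
      rewrite exchange_big /= big_seq [RHS]big_seq; apply: eq_bigr => v vg.
      have [_ _ vE] := wP v vg.
      transitivity (n^-1 *: \sum_(u <- s) w v u *: u); last by rewrite -vE.
      by rewrite scaler_sumr; apply: eq_bigr => u _; rewrite scalerA.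
  move=> /gF[_ []]; apply: conv_interior => // u us.
  by rewrite ltNge; apply/negP => wu; apply: wb_gt0; exists u.
move=> [u us wu]; exists u => //; apply: conv_sub_vertices => v vg.
have [w0 w1 vE] := wP v vg.
have wvu : w v u = 0.
  apply/eqP; rewrite eq_le w0 // andbT.
  have : n^-1 * w v u <= wb u.
    rewrite /wb (big_fsetD1 v) //= lerDl big_seq; apply: sumr_ge0 => z.
    rewrite !inE => /andP[_ zg].
    by rewrite mulr_ge0 ?invr_ge0 ?(ltW n0)//; have [->] := wP z zg.
  by move=> /le_trans/(_ wu); rewrite pmulr_rle0 // invr_gt0.
exists (w v); split.
- by move=> z; rewrite !inE => /andP[_]; apply: w0.
- by rewrite -w1 [RHS](big_fsetD1 u) //= wvu add0r.
- by rewrite {1}vE (big_fsetD1 u) //= wvu scale0r add0r.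
Qed.

End HomogeneousCoordinates.

(** * Faces of a simplicial complex *)

Section SimplicialComplexes.
Variables (R : realType) (k : nat).
Implicit Types (C : {fset face R k}) (g h : face R k).

(** The complex property gives |g| = |g & h|, so g and its face g & h have the
    same number of vertices. *)
Lemma face_conv_sub C g h : simplicial_complex C -> g \in C -> h \in C ->
  (conv g `<=` conv h)%classic -> g `<=` h.
Proof.
move=> cC gC hC gh; apply/fsetIidPl/eqP.
rewrite eqEfcard fsubsetIl /=; apply: card_conv_sub (sc_independent cC gC) _.
by rewrite -(sc_meet cC gC hC) => x xg; split => //; apply: gh.
Qed.

(** |g| and |h| meet in a proper, possibly empty, face of g, which lies in the
    frontier of |g|. *)
Lemma face_avoids_interior C g h x : simplicial_complex C ->
  g \in C -> h \in C -> ~~ (g `<=` h) -> conv h x -> ~ interior (conv g) x.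
Proof.
move=> cC gC hC gh xh xg.
have : conv (g `&` h) x.
  by rewrite -(sc_meet cC gC hC); split => //; apply: interior_subset.
have [->|gh0] := eqVneq (g `&` h) fset0; first exact: conv_fset0.
have : g `&` h \in boundary (simplex_complex g).
  apply: proper_face_boundary gh0 _; first exact: sc_independent gC.
  by rewrite fproperE fsubsetIl fsubsetI fsubset_refl.
rewrite mem_boundary support_simplex_complex => /andP[_ /asboolP + xgh].
by move=> /(_ _ xgh) [].
Qed.

Lemma int_face_interior C g : g \in int_faces C ->
  exists2 x, conv g x & interior (Defs.support C) x.
Proof.
rewrite mem_int_faces => /andP[gC /asboolPn gF].
apply: contra_notP gF => gN x xg; split.
  by apply: subset_closure; exists g.
by move=> xC; apply: gN; exists x.
Qed.

End SimplicialComplexes.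

(** * The faces of a simple subdivision *)

Section SimpleSubdivision.
Variables (R : realType) (k : nat).
Variables (D D'' D' : {fset face R k}) (s : face R k).
Hypothesis H : simple_subdivision D s D'' D'.
Implicit Types g t : face R k.

Let cD : simplicial_complex D. Proof. exact: ss_complex H. Qed.
Let cD'' : simplicial_complex D''. Proof. by have [] := ss_subdivision H. Qed.
Let supp'' : Defs.support D'' = conv s. Proof. by have [] := ss_subdivision H. Qed.
Let sD : s \in D.
Proof. by have := ss_cell H; rewrite mem_dim_faces => /andP[]. Qed.
Let sk : #|` s| = k.+1.
Proof. by have := ss_cell H; rewrite mem_dim_faces => /andP[_ /eqP]. Qed.
Let sI : affine_independent s. Proof. exact: sc_independent cD _ sD. Qed.

Let small_not_sup g : (#|` g| <= k)%N -> ~~ (s `<=` g).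
Proof. by apply: contraTN => /fsubset_leq_card; rewrite sk -ltnNge. Qed.

Lemma subdivision_sub : D'' `<=` D'.
Proof. by rewrite (ss_replace H) fsubsetUr. Qed.

Lemma subdivision_conv g : g \in D'' -> (conv g `<=` conv s)%classic.
Proof. by move=> gD x xg; rewrite -supp''; exists g. Qed.

Lemma old_face_outside g : g \in D' -> g \notin D'' ->
  g \in D /\ ~~ (g `<=` s).
Proof.
rewrite (ss_replace H) in_fsetU => /orP[|-> //].
by rewrite !inE => /andP[].
Qed.

Lemma subdivision_int_faces : int_faces D'' `<=` int_faces D'.
Proof.
apply/fsubsetP => g gD; have [x xg xs] := int_face_interior gD.
move: gD; rewrite !mem_int_faces => /andP[gD _].
rewrite (fsubsetP subdivision_sub) //=; apply/asboolPn => /(_ _ xg)[_].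
apply; move: x xs {xg}; apply: interiorS => x.
by rewrite (simple_subdivision_support H) supp'' => xs; exists s.
Qed.

(** The bound on the number of vertices excludes the trivial subdivision
    D'' = s, whose cell s belongs to D. *)
Lemma subdivision_int_face_new g : g \in int_faces D'' -> (#|` g| <= k)%N ->
  g \notin D.
Proof.
move=> gD gk; apply/negP => gD0; have [x xg] := int_face_interior gD.
rewrite supp''; exact: face_avoids_interior cD sD gD0 (small_not_sup gk) xg.
Qed.

(** A face of D'' in the frontier of |s| but interior in D' lies in a facet of s
    that is interior in D; as such a facet is not subdivided, the face is a face
    of it. *)
Lemma int_faces_split g : g \in int_faces D' ->
  g \in int_faces D \/ g \in int_faces D''.
Proof.
move=> gI; have := gI; rewrite mem_int_faces => /andP[gD'].
rewrite (simple_subdivision_support H) => gb.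
have [gD''|gN] := boolP (g \in D''); last first.
  by left; rewrite mem_int_faces gb andbT; have [] := old_face_outside gD' gN.
have [gb''|gb''] :=
    boolP `[< (conv g `<=` frontier (Defs.support D''))%classic >]; last first.
  by right; rewrite mem_int_faces gD'' gb''.
left; rewrite mem_int_faces gb andbT.
have g0 : g != fset0 by apply: contraTneq gD'' => ->; exact: sc_nonempty cD''.
have [v vg] := fset0Pn _ g0.
move: gb''; rewrite supp'' => /asboolP gF.
have [u us gu] := conv_facet sI sk g0 (subdivision_conv gD'') gF.
have t0 : s `\ u != fset0.
  apply/eqP => t0; move: gu; rewrite t0 => /(_ _ (conv_vertex vg)).
  exact: conv_fset0.
have tD : s `\ u \in D by apply: sc_closed sD _ t0 => //; exact: fsubD1set.
have tI : s `\ u \in int_faces D.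
  rewrite mem_int_faces tD; apply: contra gb => /asboolP tF.
  by apply/asboolP => x /gu /tF.
have tD'' := simple_subdivision_not_subdivided H tI (fproperD1 us).
apply: sc_closed tD _ g0 => //.
exact: face_conv_sub cD'' gD'' tD'' gu.
Qed.

(** A face of D' that contributes to J has only k vertices, so it does not
    contain s; if it were not in D'', it would be a face of D and miss the
    interior of |s|, where g has a point. *)
Lemma J_subdivision r ell g : g \in int_faces D'' ->
  J r ell D' g =i J r ell D'' g.
Proof.
move=> gI; rewrite /J.
suff -> : [fset t in D' | (#|` t| == k) && (g `<=` t)] =
          [fset t in D'' | (#|` t| == k) && (g `<=` t)] by [].
apply/fsetP => t; rewrite !inE /=; apply: andb_id2r => /andP[/eqP tk gt].
apply/idP/idP => [tD'|]; last exact: (fsubsetP subdivision_sub).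
apply/negPn/negP => tN; have [tD _] := old_face_outside tD' tN.
have [x /(conv_sub gt) xt] := int_face_interior gI.
rewrite supp''; apply: face_avoids_interior cD sD tD _ xt.
by apply: small_not_sup; rewrite tk.
Qed.

Lemma subdivision_cells : dim_faces k D'' `<=` dim_faces k D'.
Proof.
apply/fsubsetP => g; rewrite !mem_dim_faces => /andP[gD ->].
by rewrite (fsubsetP subdivision_sub).
Qed.

(** If g differs from s, then |g'| lies in the proper face g & s of s, which has
    too few vertices to contain a k-simplex. *)
Lemma cell_refines_subdivision g g' : g \in dim_faces k D ->
  g' \in dim_faces k D'' -> `[< (conv g' `<=` conv g)%classic >] = (g == s).
Proof.
rewrite !mem_dim_faces => /andP[gD /eqP gk] /andP[gD'' /eqP g'k].
apply/idP/eqP => [/asboolP g'g|->]; last exact/asboolP/subdivision_conv.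
apply/eqP; rewrite eq_sym eqEfcard sk gk leqnn andbT.
have : (#|` g'| <= #|` s `&` g|)%N.
  apply: card_conv_sub (sc_independent cD'' gD'') _ => x xg.
  by rewrite -(sc_meet cD sD gD); split; [apply: subdivision_conv xg|apply: g'g].
rewrite g'k -sk => h; apply/fsetIidPl/eqP.
by rewrite eqEfcard fsubsetIl.
Qed.

Lemma cell_refines_old g g' : g \in dim_faces k D ->
  g' \in dim_faces k D' -> g' \notin D'' ->
  `[< (conv g' `<=` conv g)%classic >] = (g == g').
Proof.
rewrite !mem_dim_faces => /andP[gD /eqP gk] /andP[gD' /eqP g'k] g'N.
have [g'D _] := old_face_outside gD' g'N.
apply/idP/eqP => [/asboolP g'g|->]; last exact/asboolP.
apply/eqP; rewrite eq_sym eqEfcard g'k gk.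
by rewrite leqnn andbT (face_conv_sub cD).
Qed.

Lemma old_cell g : g \in dim_faces k D' -> g \notin D'' ->
  g \in dim_faces k D /\ g != s.
Proof.
rewrite !mem_dim_faces => /andP[gD' ->] /(old_face_outside gD')[-> gs].
by split => //; apply: contraNneq gs => ->.
Qed.

End SimpleSubdivision.

(** * The cokernels *)

Section TopDegree.
Variables (R : realType) (k : nat).
Variables (D D'' D' : {fset face R k}) (s : face R k).
Hypothesis H : simple_subdivision D s D'' D'.

Lemma diagE (C : {fset face R k}) f (g : dim_faces k C) : diag C f g = f.
Proof. exact: (sum_dinj_in (b := id)). Qed.

Lemma taut_topE (x : RJ_top D) (g' : dim_faces k D') : taut_top D D' x g' =
  \sum_(g : dim_faces k D | `[< conv (val g') `<=` conv (val g) >]%classic) x g.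
Proof.
rewrite /taut_top dsum_sumE [RHS]big_mkcond; apply: eq_bigr => g _.
rewrite dsum_sumE big_mkcond (bigD1 g') //= dinj_in big1 ?addr0 // => h hg.
by rewrite dinj_out // if_same.
Qed.

Let cell_s : dim_faces k D := [` ss_cell H].
Let emb : dim_faces k D'' -> dim_faces k D' := fincl (subdivision_cells H).

Lemma taut_top_in x g : taut_top D D' x (emb g) = x cell_s.
Proof.
rewrite taut_topE (big_pred1 cell_s) // => h /=.
by rewrite (cell_refines_subdivision H (valP h) (valP g)).
Qed.

Lemma taut_top_out x (g' : dim_faces k D') (g : dim_faces k D) :
  val g' \notin D'' -> val g = val g' -> taut_top D D' x g' = x g.
Proof.
move=> g'N gg'; rewrite taut_topE (big_pred1 g) // => h /=.
by rewrite (cell_refines_old H (valP h) (valP g')) // -gg'.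
Qed.

Let res (x : RJ_top D') : RJ_top D'' := [ffun g => x (emb g)].

Let res_linear : linear res.
Proof. by move=> c x y; apply/ffunP => g; rewrite !ffunE. Qed.

HB.instance Definition _ := GRing.isLinear.Build _ (RJ_top D') (RJ_top D'') _
  res res_linear.

Let ext (y : RJ_top D'') : RJ_top D' := \sum_g dinj (emb g) (y g).

Let extK y : res (ext y) = y.
Proof.
by apply/ffunP => g; rewrite ffunE (sum_dinj_in _ _ (@fincl_inj _ _ _ _)).
Qed.

Lemma graded_iso_coker_taut_top :
  graded_iso (coker_gr (RJ_top_gr D') (taut_top D D'))
             (coker_gr (RJ_top_gr D'') (diag D'')).
Proof.
pose phi : {linear RJ_top D' -> coker (diag D'')} :=
  (lproj (lrange (diag D'')) \o res)%FUN.
apply: (@graded_iso_coker _ _ _ _ _ phi) => [v|w|d v vd|d w [y yd <-]].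
- have -> : phi v = 0 <-> exists f, res v = diag D'' f.
    split=> [/eqP|[f vf]].
      by rewrite -(linear0 (lproj _)) lproj_eq subr0 => /asboolP.
    apply/eqP; rewrite -(linear0 (lproj _)) lproj_eq subr0.
    by apply/asboolP; exists f.
  split=> [[f vf]|[x ->]]; last first.
    by exists (x cell_s); apply/ffunP => g; rewrite ffunE taut_top_in diagE.
  exists [ffun g => if val g == s then f
                    else if insub (val g) is Some g' then v g' else 0].
  apply/ffunP => g'; have [g'D|g'N] := boolP (val g' \in D'').
    have g'D'' : val g' \in dim_faces k D''.
      by have := valP g'; rewrite !mem_dim_faces g'D => /andP[].
    have -> : g' = emb [` g'D''] by apply: val_inj.
    rewrite taut_top_in ffunE eqxx.
    by have := congr1 (fun z : RJ_top D'' => z [` g'D'']) vf; rewrite ffunE diagE.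
  have [gD gs] := old_cell H (valP g') g'N.
  by rewrite (@taut_top_out _ g' [` gD]) // ffunE /= (negbTE gs) valK.
- by exists (ext (lrepr w)); rewrite /phi /= extK lreprK.
- by exists (res v) => // g; rewrite ffunE; apply: vd.
- exists (ext y); last by rewrite /phi /= extK.
  move=> g'; have [/existsP[g /eqP <-]|/existsPn gN] :=
      boolP [exists g, emb g == g'].
    by rewrite (sum_dinj_in _ _ (@fincl_inj _ _ _ _)); apply: yd.
  by rewrite sum_dinj_out //; exact: dhomog0.
Qed.

End TopDegree.

Section LowDegrees.
Variables (R : realType) (k r : nat) (ell : face R k -> mpoly k.+1 R).
Variables (D D'' D' : {fset face R k}) (s : face R k).
Variables (H : simple_subdivision D s D'' D') (i : nat) (ik : (i < k)%N).

Lemma graded_iso_coker_taut :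
  graded_iso (coker_gr (RJ_gr r ell D' i) (taut r ell H ik))
             (RJ_gr r ell D'' i).
Proof.
have emb : dim_faces i (int_faces D'') `<=` dim_faces i (int_faces D').
  apply/fsubsetP => g; rewrite !mem_dim_faces => /andP[gD ->].
  by rewrite (fsubsetP (subdivision_int_faces H)).
pose G C (g : dim_faces i (int_faces C)) :=
  lquot_gr (@P_gr R k) (J r ell C (val g)).
apply: (@graded_iso_coker_dsum _ _ _ _ _ _ _ (G D') (G D'')
  (fincl (simple_subdivision_int_faces H ik)) (fincl emb)
  (fun g => lquot_map (J_sub H (valP g))) (taut r ell H ik)).
- exact: fincl_inj.
- exact: fincl_inj.
- move=> g g''; apply/eqP => gg''.
  have e : val g = val g'' := congr1 val gg''.
  have := valP g''; rewrite mem_dim_faces => /andP[g''I /eqP g''k].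
  have /negP[] : val g'' \notin D.
    by apply: (subdivision_int_face_new H) => //; rewrite g''k.
  rewrite -e; have := valP g.
  by rewrite mem_dim_faces mem_int_faces => /andP[/andP[]].
- move=> g'; have := valP g'; rewrite mem_dim_faces => /andP[g'I g'k].
  have [gI|gI] := int_faces_split H g'I.
    have g'D : val g' \in dim_faces i (int_faces D) by rewrite mem_dim_faces gI.
    by left; exists [` g'D]; apply: val_inj.
  have g'D : val g' \in dim_faces i (int_faces D'') by rewrite mem_dim_faces gI.
  by right; exists [` g'D]; apply: val_inj.
- move=> g y; by exists (lproj _ (lrepr y)); rewrite lquot_map_lproj lreprK.
- by [].
- by move=> g d; exists 0; [exact: dhomog0|exact: linear0].
- move=> g; have := valP g; rewrite mem_dim_faces => /andP[gI _].
  by apply: graded_iso_lquot => f; exact: (J_subdivision H r ell gI f).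
Qed.

End LowDegrees.

Theorem theorem2p8 (R : realType) (k r : nat)
    (ell : face R k -> mpoly k.+1 R)
    (D : {fset face R k}) (s : face R k) (D'' D' : {fset face R k})
    (ell_spans : forall t, t \in D `|` D' -> #|` t| = k -> spans_face t (ell t))
    (H : split_subdivision r ell D s D'' D') :
  (forall (i : nat) (ik : (i < k)%N),
     graded_iso (coker_gr (RJ_gr r ell D' i) (taut r ell (proj1 H) ik))
                (RJ_gr r ell D'' i)) /\
  graded_iso (coker_gr (RJ_top_gr D') (taut_top D D'))
             (coker_gr (RJ_top_gr D'') (diag D'')).
Proof.
split=> [i ik|]; first exact: graded_iso_coker_taut.
exact: graded_iso_coker_taut_top (proj1 H).
Qed.
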